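(* Let $\Omega$ be a nonempty set, $F_\Omega$ the free semigroup on $\Omega$, and $\approx$ a reflexive symmetric relation on $F_\Omega$ such that $\approx\,\subseteq\,\sim_s$. Then the congruence on $F_\Omega$ generated by $\approx$ is $\sim_s$ if and only if $\alpha\beta\approx\beta\alpha$ for all $\alpha,\beta\in\Omega$.
   Context: For a semigroup $S$, $S^1$ denotes the monoid obtained by adjoining an identity element $1$ to $S$; if $S$ is already a monoid, $S^1=S$. For $s,t\in S$, $s\sim_s^1 t$ means there exist a positive integer $n$, elements $p_1,\dots,p_n\in S^1$, and a permutation $f$ of $\{1,\dots,n\}$ with $s=p_1\cdots p_n$ and $t=p_{f(1)}\cdots p_{f(n)}$; $\sim_s$ is the transitive closure of $\sim_s^1$. A congruence on $S$ is an equivalence relation compatible with left and right multiplication; the congruence generated by a relation is the least congruence containing it. *)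

(* Defs.v *)
From Stdlib Require Import RelationClasses Relation_Operators.
From HB Require Import structures.
From mathcomp Require Import all_boot all_fingroup.
From mathcomp Require Import boolp.

Set Implicit Arguments.
Unset Strict Implicit.
Unset Printing Implicit Defensive.

Local Open Scope group_scope.

(* [adjoin S] adds a new identity [None] even when S is a monoid; S^1 is the
   subset of [adjoin S] cut out by [in_S1] below. *)
Definition adjoin (S : Type) : Type := option S.

Section Adjoin.
Variable S : semigroupType.

HB.instance Definition _ := Choice.on (adjoin S).

Definition adjoin_mul (x y : adjoin S) : adjoin S :=
  match x, y with
  | Some a, Some b => Some (a * b)
  | Some a, None => Some a
  | None, _ => y
  end.

Lemma adjoin_mulA : associative adjoin_mul.
Proof. by case=> [a|] [b|] [c|] //=; rewrite mulgA. Qed.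

Lemma adjoin_mul1g : left_id None adjoin_mul.
Proof. by []. Qed.

Lemma adjoin_mulg1 : right_id None adjoin_mul.
Proof. by case. Qed.

HB.instance Definition _ :=
  isMonoid.Build (adjoin S) adjoin_mulA adjoin_mul1g adjoin_mulg1.

Definition has_identity : Prop :=
  exists e : S, left_id e (@mul S) /\ right_id e (@mul S).

(* The new identity belongs to S^1 only when S has no identity of its own;
   so S^1 is exactly (the image of) S when S is already a monoid. *)
Definition in_S1 (x : adjoin S) : Prop := x = None -> ~ has_identity.

Definition incl (s : S) : adjoin S := Some s.

(* ~_s^1; since n > 0, both products range over nonempty families and hence
   do not depend on the unit of [adjoin S] when S is a monoid. *)
Definition sim1 (s t : S) : Prop :=
  exists (n : nat) (p : 'I_n -> adjoin S) (f : 'S_n),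
    [/\ (0 < n)%N,
        forall i, in_S1 (p i),
        incl s = \prod_(i < n) p i
      & incl t = \prod_(i < n) p (f i)].

Definition sim : S -> S -> Prop := clos_trans S sim1.

Definition congruence (C : S -> S -> Prop) : Prop :=
  [/\ Equivalence C,
      forall u s t, C s t -> C (u * s) (u * t)
    & forall u s t, C s t -> C (s * u) (t * u)].

Definition congruence_gen (R : S -> S -> Prop) (s t : S) : Prop :=
  forall C, congruence C -> (forall x y, R x y -> C x y) -> C s t.

Lemma congruence_gen_least (R : S -> S -> Prop) :
  [/\ congruence (congruence_gen R),
      forall s t, R s t -> congruence_gen R s t
    & forall C, congruence C -> (forall s t, R s t -> C s t) ->
      forall s t, congruence_gen R s t -> C s t].
Proof.
split=> [|s t Rst C _|C hC RC s t]; [|exact|exact].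
split; [split|..].
- by move=> x C [[Crefl _ _] _ _] _; apply: Crefl.
- move=> x y Rxy C hC RC; have [[_ Csym _] _ _] := hC.
  exact: Csym (Rxy C hC RC).
- move=> x y z Rxy Ryz C hC RC; have [[_ _ Ctrans] _ _] := hC.
  exact: Ctrans (Rxy C hC RC) (Ryz C hC RC).
- move=> u s t Rst C hC RC; have [_ Cl _] := hC; exact: Cl (Rst C hC RC).
- move=> u s t Rst C hC RC; have [_ _ Cr] := hC; exact: Cr (Rst C hC RC).
Qed.

End Adjoin.

Record free_semigroup (Omega : Type) : Type := FreeSemigroup {
  word : seq Omega;
  word_neq_nil : ~~ nilp word
}.

Section FreeSemigroup.
Variable Omega : Type.

HB.instance Definition _ := [isSub for @word Omega].

(* [semigroupType] requires a choiceType carrier; classically every type is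
   one, so that Omega can be an arbitrary type. *)
HB.instance Definition _ := gen_eqMixin (free_semigroup Omega).
HB.instance Definition _ := gen_choiceMixin (free_semigroup Omega).

Lemma cat_neq_nil (u v : free_semigroup Omega) : ~~ nilp (word u ++ word v).
Proof. by case: u => -[]. Qed.

Definition free_mul (u v : free_semigroup Omega) : free_semigroup Omega :=
  FreeSemigroup (cat_neq_nil u v).

Lemma free_mulA : associative free_mul.
Proof. by move=> u v w; apply: val_inj; rewrite /= catA. Qed.

HB.instance Definition _ := isSemigroup.Build (free_semigroup Omega) free_mulA.

Definition letter (a : Omega) : free_semigroup Omega :=
  @FreeSemigroup Omega [:: a] isT.

End FreeSemigroup.

(* Main.v *)
Require Import Defs.
From Stdlib Require Import RelationClasses Relation_Operators.
From mathcomp Require Import all_boot all_fingroup.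
From mathcomp Require Import boolp.

(** In every semigroup [sim] is a congruence, so the congruence generated by
    [approx] lies in [sim].  In a free semigroup, two words related by [sim]
    are rearrangements of each other ([sim_same_letters]).

    If letters commute up to [approx], the converse inclusion holds because a
    congruence that swaps adjacent letters identifies all rearrangements of a
    word ([same_letters_congr]).

    For the other implication, the point is that words of length two cannot be
    related in the generated congruence unless they already are in [approx]:
    multiplication creates a word of length two only from single letters, on
    which [sim] is equality, and transitivity adds nothing because the [sim]
    class of such a word has at most the two elements [a b] and [b a].  Thus
    the part of [sim] that agrees with [approx] on words of length two is a
    congruence ([congruence_short_approx]); it contains [approx], hence the
    generated congruence, and the latter contains the pair [a b], [b a] as soon
    as it equals [sim]. *)

Set Implicit Arguments.
Unset Strict Implicit.
Unset Printing Implicit Defensive.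

Local Open Scope group_scope.

(** * The relation [sim] in an arbitrary semigroup *)

Section Sim.
Variable S : semigroupType.
Implicit Types s t u : S.

Lemma sim1_refl s : sim1 s s.
Proof.
exists 1%N, (fun=> incl s), 1; split=> //; by rewrite big_ord_recl big_ord0 mulg1.
Qed.

Lemma sim1_sym s t : sim1 s t -> sim1 t s.
Proof.
case=> n [p [f [n0 pS es et]]]; exists n, (p \o f), f^-1; split=> //.
- by move=> i; apply: pS.
- by rewrite es; apply: eq_bigr => i _; rewrite /= permKV.
Qed.

(** The factor [u] becomes a new first factor of the product, which the
    extended permutation fixes. *)
Lemma sim1_mull u s t : sim1 s t -> sim1 (u * s) (u * t).
Proof.
case=> n [p [f [n0 pS es et]]].
exists n.+1, (fun i => oapp p (incl u) (unlift ord0 i)), (lift_perm ord0 ord0 f).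
split=> //.
- by move=> i; case: unliftP => [j _|_] /=.
- rewrite big_ord_recl unlift_none /=.
  under eq_bigr => i _ do rewrite liftK /=.
  by rewrite -es.
- rewrite big_ord_recl lift_perm_id unlift_none /=.
  under eq_bigr => i _ do rewrite lift_perm_lift liftK /=.
  by rewrite -et.
Qed.

Lemma sim1_mulr u s t : sim1 s t -> sim1 (s * u) (t * u).
Proof.
case=> n [p [f [n0 pS es et]]].
pose q (i : 'I_n.+1) := oapp p (incl u) (unlift ord_max i).
have widenE (i : 'I_n) : widen_ord (leqnSn n) i = lift ord_max i.
  by apply: ord_inj; rewrite lift_max.
exists n.+1, q, (lift_perm ord_max ord_max f); split=> //.
- by move=> i; rewrite /q; case: unliftP => [j _|_] /=.
- rewrite big_ord_recr /q unlift_none /=.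
  under eq_bigr => i _ do rewrite widenE liftK /=.
  by rewrite -es.
- rewrite big_ord_recr /q /= lift_perm_id unlift_none /=.
  under eq_bigr => i _ do rewrite widenE lift_perm_lift liftK /=.
  by rewrite -et.
Qed.

Lemma sim1_mulC s t : sim1 (s * t) (t * s).
Proof.
exists 2, (fun i => if i == ord0 then incl s else incl t), (tperm ord0 ord_max).
split=> //.
- by move=> i; case: ifP.
- by rewrite !big_ord_recl big_ord0.
- rewrite !big_ord_recl big_ord0 tpermL.
  have -> : lift ord0 ord0 = ord_max :> 'I_2 by apply: val_inj.
  by rewrite tpermR.
Qed.

(** The step relation [sim1] is reflexive, symmetric and stable under
    multiplication; all of these pass to the transitive closure. *)
Lemma sim_congruence : congruence (@sim S).
Proof.
have map_sim (h : S -> S) : (forall s t, sim1 s t -> sim1 (h s) (h t)) ->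
    forall s t, sim s t -> sim (h s) (h t).
  move=> hh s t; elim=> {s t} [s t st|s t v _ hst _ htv].
    exact/t_step/hh.
  exact: t_trans hst htv.
split; [split|..].
- by move=> s; apply: t_step; apply: sim1_refl.
- move=> s t; elim=> {s t} [s t /sim1_sym|s t v _ hst _ htv]; first exact: t_step.
  exact: t_trans htv hst.
- by move=> s t u; apply: t_trans.
- by move=> u; apply: map_sim => s t; apply: sim1_mull.
- by move=> u; apply: (map_sim (fun s => s * u)) => s t; apply: sim1_mulr.
Qed.

End Sim.

(** * Rearrangements of words *)

Section Words.
Variable Omega : Type.
Local Notation F := (free_semigroup Omega).
Implicit Types s t u : F.

Definition adjoin_word (x : adjoin F) : seq Omega := oapp (@word Omega) [::] x.

Lemma count_adjoin_word_prod (a : pred Omega) n (p : 'I_n -> adjoin F) :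
  count a (adjoin_word (\prod_(i < n) p i)) =
  (\sum_(i < n) count a (adjoin_word (p i)))%N.
Proof.
apply: (big_morph (fun x => count a (adjoin_word x))) => // x y.
by case: x y => [x|] [y|] //=; rewrite ?addn0 // count_cat.
Qed.

(** Since [Omega] is an arbitrary type, words are compared as sequences over
    [{classic Omega}], which carries a classical decidable equality. *)
Definition same_letters s t : bool :=
  @perm_eq {classic Omega} (word s) (word t).

(** The number of occurrences of a letter in a product is the sum of its
    numbers of occurrences in the factors, whatever their order. *)
Lemma sim_same_letters s t : sim s t -> same_letters s t.
Proof.
rewrite /same_letters; elim=> {s t} [s t|s t u _ st _ tu]; last exact: perm_trans st tu.
case=> n [p [f [_ _ es et]]]; apply/(@seq.permP {classic Omega}) => a.
rewrite -[word s]/(adjoin_word (incl s)) -[word t]/(adjoin_word (incl t)) es et.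
by rewrite !count_adjoin_word_prod; apply: (reindex_perm f).
Qed.

Definition cons_word (a : Omega) (w : seq Omega) : F :=
  @FreeSemigroup Omega (a :: w) isT.

Lemma cons_wordP s : exists a w, s = cons_word a w.
Proof.
by case: s => -[|a w] // wN; exists a, w; apply: val_inj.
Qed.

Lemma cons_word1 a : cons_word a [::] = letter a.
Proof. exact: val_inj. Qed.

Lemma cons_word_cat a b v w :
  cons_word a (v ++ b :: w) = cons_word a v * cons_word b w.
Proof. exact: val_inj. Qed.

Lemma cons_word_cons a b w : cons_word a (b :: w) = letter a * cons_word b w.
Proof. exact: val_inj. Qed.

Section Commuting.
Variable C : F -> F -> Prop.
Hypothesis congrC : congruence C.
Hypothesis commC : forall a b, C (letter a * letter b) (letter b * letter a).

(** The swap of [a] and [b] is multiplied by [w], except that an empty [w] leaves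
    nothing to multiply by. *)
Lemma congr_swap a b w : C (cons_word a (b :: w)) (cons_word b (a :: w)).
Proof.
have [_ _ Cr] := congrC.
case: w => [|c w]; first by rewrite !cons_word_cons !cons_word1.
rewrite (cons_word_cat a c [:: b] w) (cons_word_cat b c [:: a] w).
by apply: Cr; rewrite !cons_word_cons !cons_word1.
Qed.

(** The letter [a] travels leftwards by adjacent swaps. *)
Lemma congr_move_front a b v w :
  C (cons_word b (v ++ a :: w)) (cons_word a (b :: v ++ w)).
Proof.
have [[_ _ Ctrans] Cl _] := congrC.
elim: v b => [|c v IHv] b; first exact: congr_swap.
apply: Ctrans (congr_swap b a (c :: v ++ w)).
by rewrite !(cons_word_cons b); apply: Cl.
Qed.

(** Move the first letter of one word to the front of the other, cancel it and
    recurse on the tails.  Words are kept in the form [cons_word a v] so that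
    the recursion never meets the empty word, which is not in [F]. *)
Lemma same_letters_congr s t : same_letters s t -> C s t.
Proof.
have [[Crefl Csym Ctrans] Cl _] := congrC.
have [a [v ->]] := cons_wordP s; have [b [w ->]] := cons_wordP t.
rewrite /same_letters /= => {s t}.
elim: v a b w => [|c v IHv] a b w vw.
  have /(@perm_small_eq {classic Omega} _ [:: _] isT) [-> ->] : @perm_eq {classic Omega} (b :: w) [:: a].
    by rewrite perm_sym.
  exact: Crefl.
(* Two words with the same first letter [a]: cancel it and use [IHv]. *)
have tails x y : @perm_eq {classic Omega} (c :: v) (x :: y) ->
    C (cons_word a (c :: v)) (cons_word a (x :: y)).
  by move=> /IHv vxy; rewrite !(cons_word_cons a); apply: Cl.
have [ab|nab] := eqVneq (a : {classic Omega}) b.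
  move: vw; rewrite -ab perm_cons; case: w => [|x y]; last exact: tails.
  by move=> /perm_size.
have aw : (a : {classic Omega}) \in (w : seq {classic Omega}).
  have := perm_mem vw a; rewrite mem_head inE (negPf nab) /=; by move=> <-.
case/splitPr: aw vw => w1 w2 vw.
apply: Ctrans (Csym _ _ (congr_move_front a b w1 w2)); apply: tails.
move: vw; rewrite perm_sym -[b :: _]/((b :: w1) ++ [:: a] ++ w2).
by rewrite perm_catCA /= perm_cons perm_sym.
Qed.

End Commuting.

(** * Words of length two *)

Lemma same_letters_size s t : same_letters s t -> size (word s) = size (word t).
Proof. exact: perm_size. Qed.

Lemma same_letters1 s t : size (word s) = 1%N -> same_letters s t -> s = t.
Proof.
by move=> s1 st; apply/val_inj/(perm_small_eq _ st); rewrite -(same_letters_size st) s1.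
Qed.

Lemma same_letters2 a b t : same_letters (letter a * letter b) t ->
  t = letter a * letter b \/ t = letter b * letter a.
Proof.
case: t => -[|c [|d [|e w]]] // wN st; try by have := same_letters_size st.
have /orP [/eqP ca|/eqP cb] :
    ((c : {classic Omega}) == a) || ((c : {classic Omega}) == b).
  by have := perm_mem st c; rewrite /= !inE eqxx.
- left; apply: val_inj => /=; subst c; move: st.
  by rewrite /same_letters /= perm_cons => /(@perm_small_eq {classic Omega} _ [:: _] isT) [->].
right; apply: val_inj => /=; subst c; move: st.
rewrite /same_letters /= (@perm_catC {classic Omega} [:: a] [:: b]) /= perm_cons.
by move=> /(@perm_small_eq {classic Omega} _ [:: _] isT) [->].
Qed.

Lemma word2P s : size (word s) = 2%N -> exists a b, s = letter a * letter b.
Proof.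
by case: s => -[|a [|b []]] // wN _; exists a, b; apply: val_inj.
Qed.

Lemma size_word_gt0 s : (0 < size (word s))%N.
Proof. by rewrite lt0n; apply: word_neq_nil. Qed.

Section ShortApprox.
Variable approx : F -> F -> Prop.
Hypothesis approx_refl : Reflexive approx.
Hypothesis approx_sym : Symmetric approx.

Definition short_approx s t : Prop :=
  sim s t /\ (size (word s) = 2%N -> approx s t).

(** Stability under multiplication is free, since a product of length two has
    factors of length one and [sim] is equality there.  Transitivity holds
    although [approx] need not be transitive: three words in the class of
    [a b] cannot be pairwise distinct. *)
Lemma congruence_short_approx : congruence short_approx.
Proof.
have [[simrefl simsym simtrans] siml simr] := sim_congruence F.
have factor1 u s : (size (word u) + size (word s) = 2)%N -> size (word s) = 1%N.
  move: (size_word_gt0 u) (size_word_gt0 s).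
  by case: (size _) => [|[|m]] //; case: (size _) => [|[|k]] //; rewrite ?addnS.
split; [split|..].
- by move=> s; split.
- move=> s t [st ast]; split; first exact: simsym.
  move=> t2; apply/approx_sym/ast.
  by rewrite (same_letters_size (sim_same_letters st)).
- move=> s t u [st ast] [tu atu]; split; first exact: simtrans tu.
  move=> s2; have ast' := ast s2.
  have atu' : approx t u.
    by apply: atu; rewrite -(same_letters_size (sim_same_letters st)).
  have [a [b sE]] := word2P s2.
  have tE := sim_same_letters st; have uE := sim_same_letters (simtrans _ _ _ st tu).
  rewrite sE in tE uE.
  case: (same_letters2 uE) => uE'; first by rewrite sE uE'.
  by case: (same_letters2 tE) => tE'; [rewrite sE -tE' | rewrite uE' -tE'].
- move=> u s t [st _]; split; first exact: siml.
  rewrite size_cat => /factor1 s1.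
  by rewrite (same_letters1 s1 (sim_same_letters st)).
- move=> u s t [st _]; split; first exact: simr.
  rewrite size_cat addnC => /factor1 s1.
  by rewrite (same_letters1 s1 (sim_same_letters st)).
Qed.

End ShortApprox.

End Words.

(** * Characterization of the relations generating [sim] *)

Theorem proposition18 (Omega : Type) (Omega_nonempty : inhabited Omega)
    (approx : free_semigroup Omega -> free_semigroup Omega -> Prop)
    (approx_refl : Reflexive approx) (approx_sym : Symmetric approx)
    (approx_sim : forall s t, approx s t -> sim s t) :
  (forall s t, congruence_gen approx s t <-> sim s t) <->
  (forall a b : Omega, approx (letter a * letter b) (letter b * letter a)).
Proof.
split=> [gen_sim a b|comm s t]; last first.
  split=> [gst|/sim_same_letters st C congrC approxC].
    by apply: gst => //; apply: sim_congruence.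
  by apply: (same_letters_congr congrC) => // a b; apply/approxC/comm.
have gab : congruence_gen approx (letter a * letter b) (letter b * letter a).
  by apply/gen_sim/t_step/sim1_mulC.
have [|_ ] := gab _ (congruence_short_approx approx_refl approx_sym).
  by move=> s t ast; split; first exact: approx_sim.
exact.
Qed.
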